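(* Let $\mathcal N$ be a completion ring for $\mu$ and $\nu = \mathfrak C_{\mathcal N}\mu$. Then $D_\nu = \kappa(D_\mu\cup\mathcal N)$, $\nu$ admits completion and is an extension of $\mu$, $\mathcal N_\nu = \mathcal N$, and $S[\nu] = S[\mu]\cup\bigcup\mathcal N$. The equality $\nu = \mu$ holds if and only if $\mathcal N = \mathcal N_\mu$.
   Context: $D_\mu$ denotes the domain of a map $\mu$; all maps here have as domain a set of sets, and their values are arbitrary. Two maps are equal if they have the same domain and the same values; $\nu$ is an extension of $\mu$ if $D_\mu\subset D_\nu$ and $\nu=\mu$ on $D_\mu$. $S[\mu]=\bigcup D_\mu$. A ring (of sets) is a nonempty set of sets closed under union $A\cup B$ and difference $A\setminus B$; $\kappa(\mathcal K)$ is the smallest ring containing the set of sets $\mathcal K$. $A\Delta B=(A\setminus B)\cup(B\setminus A)$. For a map $\mu$ with $\varnothing\in D_\mu$, a set $N\in D_\mu$ is $\mu$-null if $\mu(N')=\mu(\varnothing)$ for every $N'\in D_\mu$ with $N'\subset N$; $\mathcal N_\mu$ is the set of all $\mu$-null sets. The map $\mu$ admits completion if $D_\mu$ is a ring and $\mu(B_1)=\mu(B_2)$ for all $B_1,B_2\in D_\mu$ with $B_1\Delta B_2\in\mathcal N_\mu$. If $\mu$ admits completion, a completion ring for $\mu$ is a ring $\mathcal N$ such that $N\cap B\in\mathcal N$ for all $N\in\mathcal N$, $B\in D_\mu$, and $\mathcal N\cap D_\mu=\mathcal N_\mu$ (saying that $\mathcal N$ is a completion ring for $\mu$ includes that $\mu$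 admits completion). For sets of sets $\mathcal Q,\mathcal N$, $\Delta(\mathcal Q,\mathcal N)=\{A: A\Delta B\in\mathcal N\text{ for some }B\in\mathcal Q\}$. The $\mathcal N$-completion $\mathfrak C_{\mathcal N}\mu$ is the unique (well-defined) map $\nu$ with $D_\nu=\Delta(D_\mu,\mathcal N)$ and $\nu(A)=\mu(B)$ whenever $A\in D_\nu$, $B\in D_\mu$, $A\Delta B\in\mathcal N$. *)

(* Defs.v *)
From mathcomp Require Import all_boot.
From mathcomp Require Import boolp classical_sets measurable_structure.

Set Implicit Arguments.
Unset Strict Implicit.
Unset Printing Implicit Defensive.

Local Open Scope classical_set_scope.

(* A map whose domain is a set of subsets of T: the domain consists of the A
   with mu A <> None.  Leibniz equality of such maps is thus equality of the
   domains and of the values, and for A, B in the domain, mu A = mu B says that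
   the values are equal. *)
Definition setmap (T V : Type) := set T -> option V.

Section setmaps.
Variables T V : Type.
Implicit Types (mu nu : setmap T V) (A B : set T) (Q N : set (set T)).

Definition dom mu : set (set T) := [set A | mu A <> None].

Definition ground mu : set T := \bigcup_(A in dom mu) A.

Definition extension mu nu :=
  dom mu `<=` dom nu /\ forall A, dom mu A -> nu A = mu A.

(* Meaningful only when set0 is in the domain of mu. *)
Definition null_sets mu : set (set T) :=
  [set A | dom mu A /\ forall B, dom mu B -> B `<=` A -> mu B = mu set0].

Definition admits_completion mu :=
  setring (dom mu) /\
  forall A B, dom mu A -> dom mu B -> null_sets mu (A `+` B) -> mu A = mu B.

Definition completion_ring mu N :=
  [/\ admits_completion mu, setring N,
      forall A B, N A -> dom mu B -> N (A `&` B)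
    & N `&` dom mu = null_sets mu].

Definition Delta Q N : set (set T) := [set A | exists2 B, Q B & N (A `+` B)].

Definition is_completion N mu nu :=
  dom nu = Delta (dom mu) N /\
  forall A B, dom nu A -> dom mu B -> N (A `+` B) -> nu A = mu B.

(* By completionP below, this is the only map satisfying is_completion N mu
   when N is a completion ring for mu; otherwise its values may depend on the
   choice of B. *)
Definition completion N mu : setmap T V := fun A =>
  if pselect (Delta (dom mu) N A) is left AN then mu (projT1 (cid2 AN))
  else None.

End setmaps.

Lemma setring_nonemptyP T (G : set (set T)) :
  setring G <-> [/\ G !=set0, setU_closed G & setD_closed G].
Proof.
split=> [[G0 GU GD]|[[A GA] GU GD]]; split=> //; first by exists set0.
by rewrite -(setDv A); exact: GD.
Qed.

Lemma dom_completion T V N (mu : setmap T V) :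
  dom (completion N mu) = Delta (dom mu) N.
Proof.
apply/seteqP; split=> A; rewrite /dom /completion /=; case: pselect => // AN _.
by case: (cid2 AN).
Qed.

Lemma completionP T V N (mu nu : setmap T V) : completion_ring mu N ->
  is_completion N mu nu <-> nu = completion N mu.
Proof.
move=> [[[D0 DU DD] mu_eq] [N0 NU ND] _ NI].
have comp : is_completion N mu (completion N mu).
  split=> [|A B _ DB NAB]; first exact: dom_completion.
  rewrite /completion; case: pselect => [AN|]; last by case; exists B.
  case: (cid2 AN) => C DC NAC /=; apply: mu_eq => //.
  have NCB : N (C `+` B).
    have -> : C `+` B = (A `+` C) `+` (A `+` B).
      by rewrite (setYC A C) setYA -(setYA C) setYK setY0.
    by apply: NU; apply: ND.
  rewrite -NI; split=> //.
  by apply: DU; apply: DD.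
split=> [[Dnu nuE]|-> //]; apply/funext => A.
have [[B DB NAB]|AN] := pselect (Delta (dom mu) N A).
  rewrite (nuE A B) //; last by rewrite Dnu; exists B.
  by rewrite (comp.2 A B) // comp.1; exists B.
have nN (f : setmap T V) : dom f = Delta (dom mu) N -> f A = None.
  move=> Df; case fA: (f A) => [v|] //; case: AN.
  by rewrite -Df /dom /= fA.
by rewrite !nN // comp.1.
Qed.

(* Main.v *)
Require Import Defs.
From mathcomp Require Import all_boot.
From mathcomp Require Import boolp classical_sets measurable_structure.
Local Open Scope classical_set_scope.

(** Read sets of sets in the Boolean ring of all subsets, with symmetric
    difference as addition and intersection as multiplication.  Rings of sets
    are then its (nonunital) subrings.  If [Q] and [N] are rings of sets and
    [N] absorbs intersections with [Q], then [N] is an ideal of the subring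
    [Q + N], which is [Delta Q N] because every set is its own opposite; so
    [Delta Q N] is the ring generated by [Q] and [N] ([Delta_setring],
    [Delta_generated]).  With [Q = dom mu] this gives the domain and the union
    of the domain of the completion [nu].

    The value of [nu] at [A] is the value of [mu] at any [B] in [dom mu]
    congruent to [A] modulo [N].  That [nu] extends [mu] and takes equal values
    at sets congruent modulo [N] is then immediate, so [nu] admits completion
    as soon as its null sets are known to be the elements of [N].  This is
    [null_sets_completion], the only clause that is not formal: [N] is not
    assumed to be closed under arbitrary subsets, and each inclusion amounts to
    showing that some element of [dom mu] lies in [N]. *)

Ltac set_identity :=
  rewrite /setY; apply/seteqP; split; let x := fresh in intro x; simpl;
  repeat match goal with
  | S : set _ |- context [?S x] =>
      lazymatch goal with
      | _ : S x |- _ => fail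
      | _ : ~ S x |- _ => fail
      | _ => case: (EM (S x)) => ?
      end
  end; tauto.

(** * Rings of sets and congruence modulo a ring *)

Lemma setring_setI {T} {G : set (set T)} : setring G -> setI_closed G.
Proof. by move=> [_ _ GD]; case: ((setD_closedP G).1 GD). Qed.

Lemma setring_setY {T} {G : set (set T)} : setring G -> setY_closed G.
Proof. by move=> [_ GU GD] A B GA GB; apply: GU; apply: GD. Qed.

(** The Boolean-ring presentation of rings of sets; union is recovered as
    [A + (B \ A)]. *)
Lemma setring_of_setYD {T} (G : set (set T)) :
  G set0 -> setY_closed G -> setD_closed G -> setring G.
Proof.
move=> G0 GY GD; split=> // A B GA GB.
have -> : A `|` B = A `+` (B `\` A) by set_identity.
by apply: GY => //; exact: GD.
Qed.

Lemma setY_trans {T} {N : set (set T)} (A B C : set T) :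
  setring N -> N (A `+` B) -> N (B `+` C) -> N (A `+` C).
Proof.
move=> Nring NAB NBC.
have -> : A `+` C = (A `+` B) `+` (B `+` C) by set_identity.
exact: setring_setY.
Qed.

Lemma sub_Delta {T} {Q N : set (set T)} : N set0 -> Q `<=` Delta Q N.
Proof. by move=> N0 A QA; exists A; rewrite ?setYK. Qed.

Lemma sub_Delta_modulus {T} {Q N : set (set T)} : Q set0 -> N `<=` Delta Q N.
Proof. by move=> Q0 A NA; exists set0; rewrite ?setY0. Qed.

Lemma Delta_setring {T} {Q N : set (set T)} : setring Q -> setring N ->
  (forall A B, N A -> Q B -> N (A `&` B)) -> setring (Delta Q N).
Proof.
move=> Qring Nring NQ; have [Q0 _ QD] := Qring; have [N0 _ _] := Nring.
have NY := setring_setY Nring; have NI := setring_setI Nring.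
apply: setring_of_setYD.
- exact: sub_Delta.
- move=> A1 A2 [B1 QB1 N1] [B2 QB2 N2]; exists (B1 `+` B2).
    exact: setring_setY.
  have -> : A1 `+` A2 `+` (B1 `+` B2) = (A1 `+` B1) `+` (A2 `+` B2).
    by set_identity.
  exact: NY.
- move=> A1 A2 [B1 QB1 N1] [B2 QB2 N2]; exists (B1 `\` B2); first exact: QD.
  (* Write Ai = Bi + Mi with Mi in N and expand A1 \ A2 = A1 + A1 A2. *)
  have -> : A1 `\` A2 `+` (B1 `\` B2) =
      (A1 `+` B1) `+` ((A2 `+` B2) `&` B1) `+`
      ((A1 `+` B1) `&` B2) `+` ((A1 `+` B1) `&` (A2 `+` B2)).
    by set_identity.
  apply: (NY); last exact: NI.
  apply: (NY); last exact: NQ.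
  by apply: NY => //; exact: NQ.
Qed.

Lemma Delta_generated {T} {Q N : set (set T)} : setring Q -> setring N ->
  (forall A B, N A -> Q B -> N (A `&` B)) -> Delta Q N = <<r Q `|` N >>.
Proof.
move=> Qring Nring NQ; have [Q0 _ _] := Qring; have [N0 _ _] := Nring.
apply/seteqP; split=> [A [B QB NAB]|].
  have -> : A = (A `+` B) `+` B by set_identity.
  by apply: (setring_setY (smallest_setring _)); apply: sub_setring;
    [right|left].
apply: smallest_sub; first exact: Delta_setring.
by move=> A [QA|NA]; [exact: sub_Delta|exact: sub_Delta_modulus].
Qed.

(** * The completion *)

Lemma completionE {T V} {mu : setmap T V} {N : set (set T)} {A B : set T} :
  completion_ring mu N -> dom mu B -> N (A `+` B) -> completion N mu A = mu B.
Proof.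
move=> hN DB NAB; have [Dnu nuE] := (completionP (completion N mu) hN).2 erefl.
by apply: nuE => //; rewrite Dnu; exists B.
Qed.

Lemma extension_completion {T V} {mu : setmap T V} {N : set (set T)} :
  completion_ring mu N -> extension mu (completion N mu).
Proof.
move=> hN; have [_ [N0 _ _] _ _] := hN; rewrite /extension dom_completion.
split=> [|A DA]; first exact: sub_Delta.
by apply: completionE => //; rewrite setYK.
Qed.

Lemma null_sets_completion {T V} {mu : setmap T V} {N : set (set T)} :
  completion_ring mu N -> null_sets (completion N mu) = N.
Proof.
move=> hN; have [[Dring _] Nring NQ NI] := hN.
have [[D0 _ DD] [N0 _ ND]] := (Dring, Nring).
have nu0 := (extension_completion hN).2 set0 D0.
rewrite /null_sets dom_completion; apply/seteqP; split=> A /=; last first.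
  move=> NA; split=> [|A' [B DB NA'B] A'A]; first exact: sub_Delta_modulus.
  (* As A' is contained in A, B differs from its part inside A only by a
     part of A' + B, so B itself is in N. *)
  have NB : N B.
    have -> : B = (A `&` B) `+` ((A' `+` B) `\` A).
      have -> : A' = A' `&` A by apply/esym/setIidPl.
      by set_identity.
    by apply: setring_setY => //; [exact: NQ|exact: ND].
  rewrite (completionE hN DB NA'B) nu0.
  have [_ Bnull] : null_sets mu B by rewrite -NI.
  exact: Bnull.
move=> [[B DB NAB] Anull].
suff NB : N B.
  have -> : A = (A `+` B) `+` B by set_identity.
  exact: setring_setY.
suff : null_sets mu B by rewrite -NI => -[].
split=> // B' DB' B'B.
(* B' is congruent to its trace on A, where the nullity of A applies. *)
have NAB' : N ((A `&` B') `+` B').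
  have -> : (A `&` B') `+` B' = (A `+` B) `&` B'.
    have -> : B' = B' `&` B by apply/esym/setIidPl.
    by set_identity.
  exact: NQ.
rewrite -(completionE hN DB' NAB') -nu0.
by apply: Anull; [exists B'|exact: subIsetl].
Qed.

Lemma admits_completion_completion {T V} {mu : setmap T V} {N : set (set T)} :
  completion_ring mu N -> admits_completion (completion N mu).
Proof.
move=> hN; have [[Dring _] Nring NQ _] := hN.
rewrite /admits_completion (null_sets_completion hN) dom_completion.
split=> [|A1 A2 DA1 [B DB NA2B] NA12]; first exact: Delta_setring.
have NA1B := setY_trans _ _ _ Nring NA12 NA2B.
by rewrite (completionE hN DB NA1B) (completionE hN DB NA2B).
Qed.

Lemma ground_completion {T V} {mu : setmap T V} {N : set (set T)} :
  completion_ring mu N ->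
  ground (completion N mu) = ground mu `|` \bigcup_(A in N) A.
Proof.
move=> [[[D0 _ _] _] [N0 _ _] _ _]; rewrite /ground dom_completion.
apply/seteqP; split=> x [].
- move=> A [B DB NAB] Ax; have [Bx|nBx] := EM (B x); first by left; exists B.
  by right; exists (A `+` B) => //; left.
- by move=> [A DA Ax]; exists A => //; exact: sub_Delta.
- by move=> [A NA Ax]; exists A => //; exact: sub_Delta_modulus.
Qed.

Lemma completion_id {T V} {mu : setmap T V} {N : set (set T)} :
  completion_ring mu N -> completion N mu = mu <-> N = null_sets mu.
Proof.
move=> hN; have [[Dring _] Nring NQ NI] := hN.
split=> [nu_mu|Nnull]; first by rewrite -nu_mu null_sets_completion.
have ND : N `<=` dom mu by rewrite Nnull => A [].
have domE : dom (completion N mu) = dom mu.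
  by rewrite dom_completion Delta_generated // setUidl // setring_id.
apply/esym/(completionP _ hN); split=> [|A B DA DB NAB].
  by rewrite -dom_completion domE.
by rewrite -(completionE hN DB NAB) (extension_completion hN).2.
Qed.

Theorem theorem3p9 (T V : Type) (mu nu : setmap T V) (N : set (set T))
  (hN : completion_ring mu N) (hnu : nu = completion N mu) :
  [/\ dom nu = <<r dom mu `|` N >>,
      admits_completion nu /\ extension mu nu,
      null_sets nu = N,
      ground nu = ground mu `|` \bigcup_(A in N) A
    & nu = mu <-> N = null_sets mu].
Proof.
rewrite hnu; have [[Dring _] Nring NQ _] := hN; split.
- by rewrite dom_completion Delta_generated.
- by split; [exact: admits_completion_completion|exact: extension_completion].
- exact: null_sets_completion.
- exact: ground_completion.
- exact: completion_id.
Qed.
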